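(* Let $n\in\mathbb{Z}_+^d$ be a prebasis, let $f\in X_n$ and let $s,s+v\in S_d$ for some $v\in\mathbb{Z}^d$. For any $z\in\mathbb{Z}^d$ it holds that $(s+v)(f[z])=s(f[z+v])$.
   Context: $\mathbb{N}=\{0,1,2,\dots\}$, $\mathbb{Z}_+$ is the set of positive integers, $\Sigma_N=\{0,\dots,N-1\}$. Vectors are ordered coordinatewise; $\mathbf{0},\mathbf{1}$ are constant vectors; $e_i$ are the standard basis vectors. A prebasis of dimension $d$ is any $n\in\mathbb{Z}_+^d$; put $N=\prod_i n[i]$ and $m(n,v)=\prod_{j=1}^d n[j]^{-v[j]}$ for $v\in\mathbb{Z}^d$. For $a\in\mathbb{N}$ and $\mathbf{0}\ge v_1\ge v_2$ in $\mathbb{Z}^d$, $\mathrm{base}_n(a,(v_1,v_2))[2]$ denotes the integer $a_1$ in the unique representation $a=a_0+a_1m(n,v_1)+a_2m(n,v_2)$ with integers $0\le a_0<m(n,v_1)$, $0\le a_1<m(n,v_2)/m(n,v_1)$, $a_2\ge0$. For $a\in\Sigma_N$, the multiplication cube $\mathrm{cube}_n(a)$ is the function on pairs $v_1\ge v_2$ in $\{-1,0\}^d$ given by $\mathrm{cube}_n(a)[v_1,v_2]=\mathrm{base}_n(a,(v_1,v_2))[2]$; $T_n=\{\mathrm{cube}_n(a):a\in\Sigma_N\}$. $X_n$ is the set of maps $f:\mathbb{Z}^d\to T_n$ such that $f[z][\mathbf{0},-\mathbf{1}+e_i]=f[z+e_i][-e_i,-\mathbf{1}]$ for all $z\in\mathbb{Z}^d$,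 $1\le i\le d$ (matching of the labels of adjacent $(d-1)$-dimensional hyperfaces). $S_d$ is the set of all hyperfaces (of all dimensions $0,\dots,d$) of the hypercube $[-1,0]^d$. Each $s\in S_d$ is uniquely of the form $s=\mathrm{faceAt}(p,u)=\{w\in[-1,0]^d: w[i]=p[i]\text{ whenever }u[i]=0\}$ with $p,u\in\{-1,0\}^d$ orthogonal (never $p[i]=u[i]=-1$). The label of $s=\mathrm{faceAt}(p,u)$ in $t\in T_n$ is $s(t)=t[p,p+u]$. $s+v$ is the translate of the set $s$ by $v$. *)

(* Defs.v *)
From mathcomp Require Import all_boot all_order all_algebra.
From mathcomp Require Import all_classical reals.
From mathcomp Require Import zify.

Set Implicit Arguments.
Unset Strict Implicit.
Unset Printing Implicit Defensive.

Import Order.TTheory GRing.Theory Num.Theory.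
Local Open Scope classical_set_scope.
Local Open Scope ring_scope.

Definition prebasis d (n : 'rV[nat]_d) : Prop := forall j, (0 < n ord0 j)%N.

Definition basis_prod d (n : 'rV[nat]_d) : nat := (\prod_j n ord0 j)%N.

Definition vle d (v w : 'rV[int]_d) : bool := [forall j, v 0 j <= w 0 j].

Definition e_ d (i : 'I_d) : 'rV[int]_d := delta_mx 0 i.

(* m(n, v), rational because the exponents may be of either sign. *)
Definition mfac d (n : 'rV[nat]_d) (v : 'rV[int]_d) : rat :=
  \prod_j (n 0 j)%:R ^ (- v 0 j).

Definition base_rep d (n : 'rV[nat]_d) (a : nat) (v1 v2 : 'rV[int]_d)
    (r : nat * nat * nat) : Prop :=
  let: (a0, a1, a2) := r in
  [/\ a0%:R < mfac n v1,
      a1%:R < mfac n v2 / mfac n v1 &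
      a%:R = a0%:R + a1%:R * mfac n v1 + a2%:R * mfac n v2].

(* The representation exists and is unique when 0 >= v1 >= v2
   (lemma base_rep_unique); the default (0, 0, 0) is never reached then. *)
Definition base d (n : 'rV[nat]_d) (a : nat) (v1 v2 : 'rV[int]_d) :
  nat * nat * nat := xget (0, 0, 0)%N [set r | base_rep n a v1 v2 r].

(* The middle digit a1, i.e. the second entry counting from 1. *)
Definition base_digit2 d (n : 'rV[nat]_d) (a : nat) (v1 v2 : 'rV[int]_d) : nat :=
  (base n a v1 v2).1.2.

Definition corner d (v : 'rV[int]_d) : bool :=
  [forall j, (v 0 j == -1) || (v 0 j == 0)].

Definition cube_dom d (q : 'rV[int]_d * 'rV[int]_d) : bool :=
  [&& corner q.1, corner q.2 & vle q.2 q.1].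

Definition labelling d := {q : 'rV[int]_d * 'rV[int]_d | cube_dom q} -> nat.

Definition cube d (n : 'rV[nat]_d) (a : nat) : labelling d :=
  fun q => base_digit2 n a (val q).1 (val q).2.

(* t[v1, v2]; the default is only used outside the domain of t. *)
Definition entry d (t : labelling d) (v1 v2 : 'rV[int]_d) : nat :=
  if insub (v1, v2) is Some q then t q else 0%N.

Definition T_ d (n : 'rV[nat]_d) : set (labelling d) :=
  [set cube n a | a in [set a | (a < basis_prod n)%N]].

Definition X_ d (n : 'rV[nat]_d) : set ('rV[int]_d -> labelling d) :=
  [set f | (forall z, T_ n (f z)) /\
           (forall z i, entry (f z) 0 (const_mx (-1) + e_ i) =
                        entry (f (z + e_ i)) (- e_ i) (const_mx (-1)))].

Definition face_data d (p u : 'rV[int]_d) : Prop :=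
  [/\ corner p, corner u & forall j, ~ (p 0 j = -1 /\ u 0 j = -1)].

Definition faceAt (R : realType) d (p u : 'rV[int]_d) : set 'rV[R]_d :=
  [set w | (forall j, -1 <= w 0 j <= 0) /\
           (forall j, u 0 j = 0 -> w 0 j = (p 0 j)%:~R)].
Arguments faceAt R {d} p u.

Definition hyperfaces (R : realType) d : set (set 'rV[R]_d) :=
  [set s | exists p u, face_data p u /\ s = faceAt R p u].

Definition translate (R : realType) d (s : set 'rV[R]_d) (v : 'rV[int]_d) :
  set 'rV[R]_d := [set w + map_mx intr v | w in s].

(* s(t); the pair (p, u) is unique for s in hyperfaces (lemma faceAt_inj), and
   (p, p + u) is then in the domain of t (lemma face_data_dom). *)
Definition label (R : realType) d (s : set 'rV[R]_d) (t : labelling d) : nat :=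
  let: (p, u) :=
    xget (0, 0) [set pu | face_data pu.1 pu.2 /\ s = faceAt R pu.1 pu.2] in
  entry t p (p + u).

Section Facts.
Variable d : nat.
Implicit Types (n : 'rV[nat]_d) (p u v : 'rV[int]_d).

Lemma cornerP v j : corner v -> v 0 j = -1 \/ v 0 j = 0.
Proof. by move=> /forallP /(_ j) /orP[] /eqP; [left|right]. Qed.

Lemma face_data_dom p u : face_data p u -> cube_dom (p, p + u).
Proof.
move=> [hp hu o]; apply/and3P; split=> //=; apply/forallP => j; rewrite !mxE.
  by case: (cornerP j hp) (cornerP j hu) (o j) => -> [] -> //; case.
by case: (cornerP j hu) => ->; case: (p 0 j) => // k; rewrite ?addr0 // gerDl.
Qed.

Lemma facet_dom0 (i : 'I_d) : cube_dom (0, const_mx (-1) + e_ i).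
Proof.
by apply/and3P; split; apply/forallP => j; rewrite !mxE //=; case: (j == i).
Qed.

Lemma facet_dom1 (i : 'I_d) : cube_dom (- e_ i, const_mx (-1)).
Proof.
by apply/and3P; split; apply/forallP => j; rewrite !mxE //=; case: (j == i).
Qed.

Lemma faceAt_inj (R : realType) p u p' u' : face_data p u -> face_data p' u' ->
  faceAt R p u = faceAt R p' u' -> p = p' /\ u = u'.
Proof.
have pt (a b : 'rV[int]_d) (x : R) : face_data a b -> -1 <= x <= 0 ->
    faceAt R a b (\row_j (if b 0 j == 0 then (a 0 j)%:~R else x)).
  move=> [ha hb _] hx; split=> j; rewrite mxE; last by move=> ->; rewrite eqxx.
  case: eqP => // _; case: (cornerP j ha) => ->.
    by rewrite mulrN1z lexx lerN10.
  by rewrite mulr0z lexx lerN10.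
have x0 : -1 <= (0 : R) <= 0 by rewrite lexx lerN10.
have x1 : -1 <= (-1 : R) <= 0 by rewrite lexx lerN10.
have key (a b a' b' : 'rV[int]_d) : face_data a b -> face_data a' b' ->
    faceAt R a b = faceAt R a' b' ->
    forall j, b' 0 j = 0 -> b 0 j = 0 /\ a 0 j = a' 0 j.
  move=> h h' e j b'0.
  have := pt a b 0 h x0; rewrite e => -[_ /(_ j b'0)]; rewrite mxE => E0.
  have := pt a b (-1) h x1; rewrite e => -[_ /(_ j b'0)]; rewrite mxE => E1.
  move: E0 E1; case: eqP => [-> /intr_inj -> //|_ <- /eqP].
  by rewrite eqr_oppLR oppr0 oner_eq0.
move=> h h' e.
have k1 := key _ _ _ _ h h' e; have k2 := key _ _ _ _ h' h (esym e).
have uu j : u 0 j = u' 0 j.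
  case: h h' => _ hu _ [_ hu' _].
  case: (cornerP j hu) (cornerP j hu') => E [] E'; rewrite ?E ?E' //.
    by case: (k1 _ E') => + _; rewrite E.
  by case: (k2 _ E) => + _; rewrite E'.
split; apply/rowP => j; last exact: uu.
case: (h') => hp' hu' o'; case: (h) => hp hu o.
case: (cornerP j hu') => E'; last by have [] := k1 _ E'.
have E := E'; rewrite -uu in E.
case: (cornerP j hp) => Ep; first by case: (o j).
by case: (cornerP j hp') => Ep'; [case: (o' j)|rewrite Ep Ep'].
Qed.

Lemma mfac_split n v1 v2 : prebasis n -> vle v1 0 -> vle v2 v1 ->
  exists m q : nat, [/\ (0 < m)%N, (0 < q)%N, mfac n v1 = m%:R &
                        mfac n v2 = (m * q)%N%:R].
Proof.
move=> n0 h1 h21.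
have nat_mfac v : vle v 0 ->
    mfac n v = (\prod_j n ord0 j ^ `|v ord0 j|)%N%:R.
  move=> /forallP h; rewrite /mfac natr_prod; apply: eq_bigr => j _.
  have := h j; rewrite mxE => hj.
  by rewrite natrX exprnP abszE ler0_norm.
have h2 : vle v2 0.
  apply/forallP => j; move/forallP: h1 => /(_ j); apply: le_trans.
  by move/forallP: h21; apply.
exists (\prod_j n ord0 j ^ `|v1 ord0 j|)%N.
exists (\prod_j n ord0 j ^ (`|v2 ord0 j| - `|v1 ord0 j|))%N.
split; rewrite ?nat_mfac //.
- by rewrite prodn_gt0 // => j; rewrite expn_gt0 n0.
- by rewrite prodn_gt0 // => j; rewrite expn_gt0 n0.
congr (_%:R); rewrite -big_split /=; apply: eq_bigr => j _.
rewrite -expnD subnKC //.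
have := forallP h1 j; rewrite mxE => h1j.
have {}h1j : v1 ord0 j <= 0 by [].
have h21j : v2 ord0 j <= v1 ord0 j by exact: (forallP h21 j).
lia.
Qed.

Lemma base_rep_unique n a v1 v2 : prebasis n -> vle v1 0 -> vle v2 v1 ->
  exists! r, base_rep n a v1 v2 r.
Proof.
move=> n0 h1 h21; have [m [q [m0 q0 E1 E2]]] := mfac_split n0 h1 h21.
have repE a0 a1 a2 : base_rep n a v1 v2 (a0, a1, a2) <->
    [/\ (a0 < m)%N, (a1 < q)%N & a = (a0 + (a1 + a2 * q) * m)%N].
  rewrite /base_rep E1 E2 natrM mulrAC divff ?mul1r ?pnatr_eq0 -?lt0n //.
  rewrite !ltr_nat; split=> -[-> -> E]; split=> //; last first.
    by rewrite E natrD natrM natrD natrM mulrDl addrA -mulrA [q%:R * _]mulrC.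
  apply/eqP; rewrite -(eqr_nat rat) E; apply/eqP.
  by rewrite natrD natrM natrD natrM mulrDl addrA -mulrA [q%:R * _]mulrC.
exists (a %% m, (a %/ m) %% q, (a %/ m) %/ q)%N; split.
  apply/repE; rewrite !ltn_pmod //; split=> //.
  by rewrite [X in (X * m)%N]addnC -divn_eq addnC -divn_eq.
move=> [[a0 a1] a2] /repE[h0 h1' ->].
by rewrite addnC modnMDl divnMDl // modn_small // divn_small // addn0
  addnC modnMDl divnMDl // modn_small // divn_small // addn0.
Qed.

End Facts.

(* Main.v *)
Require Import Defs.
From mathcomp Require Import all_boot all_order all_algebra.
From mathcomp Require Import all_classical reals.
From mathcomp Require Import zify lra.

(** Writing [f z] as the cube of an integer [a_z], the label of [faceAt p u] in
    [f z] is [(a_z %/ m(p)) %% m(u)], and the matching condition says that [a_z]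
    and [a_(z + e_i) %/ n_i] agree modulo [N / n_i].  If [p i = -1], then
    [m(p) = n_i m(p + e_i)] and [m(p + e_i) m(u)] divides [N / n_i], so the label
    of [faceAt (p + e_i) u] in [f z] is that of [faceAt p u] in [f (z + e_i)].
    A translation [v] between hyperfaces has coordinates in [{-1, 0, 1}] and is a
    succession of such unit steps through hyperfaces. *)

Import Order.TTheory GRing.Theory Num.Theory.
Local Open Scope ring_scope.

(** On corners [|v j|] is [- v j], so this is [mfac] with values in the natural numbers, where
    division and remainder are available. *)
Definition mnat {d} (n : 'rV[nat]_d) (v : 'rV[int]_d) : nat :=
  (\prod_j n 0%R j ^ `|v 0%R j|)%N.

Lemma mnat_gt0 {d} {n : 'rV[nat]_d} v : prebasis n -> (0 < mnat n v)%N.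
Proof. by move=> n0; rewrite prodn_gt0 // => j; rewrite expn_gt0 n0. Qed.

Lemma mfac_mnat {d} (n : 'rV[nat]_d) v : corner v -> mfac n v = (mnat n v)%:R.
Proof.
move=> hv; rewrite /mfac /mnat natr_prod; apply: eq_bigr => j _.
by case: (cornerP j hv) => ->; rewrite natrX.
Qed.

(** Orthogonality makes at most one of [p j] and [u j] equal to -1, so absolute values add in each
    exponent. *)
Lemma mnatD {d} (n : 'rV[nat]_d) {p u} : face_data p u ->
  mnat n (p + u) = (mnat n p * mnat n u)%N.
Proof.
case=> hp hu o; rewrite /mnat -big_split /=; apply: eq_bigr => j _.
rewrite -expnD !mxE.
by case: (cornerP j hp) (cornerP j hu) (o j) => -> [] -> //; case.
Qed.

Lemma entry_cube {d} (n : 'rV[nat]_d) a p u : prebasis n -> face_data p u ->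
  entry (cube n a) p (p + u) = ((a %/ mnat n p) %% mnat n u)%N.
Proof.
move=> n0 h; have hd := face_data_dom h; have /and3P[/= hp hpu hle] := hd.
rewrite /entry (insubT (@cube_dom d) hd) /cube /base_digit2 /base /=.
have hp0 : vle p 0.
  by apply/forallP => j; rewrite mxE; case: (cornerP j hp) => ->.
have [r [hr ur]] := base_rep_unique a n0 hp0 hle.
set m := mnat n p; set q := mnat n u.
have m0 : (0 < m)%N := mnat_gt0 p n0.
have q0 : (0 < q)%N := mnat_gt0 u n0.
(* Two Euclidean divisions give a representation; by uniqueness it is the one that [xget]
   returns. *)
suff /ur E : base_rep n a p (p + u) (a %% m, (a %/ m) %% q, (a %/ m) %/ q)%N.
  case: xgetP => [x _ /ur <-|/(_ r) []] //; by rewrite E.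
rewrite /base_rep !mfac_mnat // mnatD // -/m -/q natrM mulrAC divff ?mul1r;
  last by rewrite pnatr_eq0 -lt0n.
rewrite !ltr_nat !ltn_pmod //; split=> //.
rewrite -!(natrM, natrD); congr (_%:R).
rewrite [in LHS](divn_eq a m) [in LHS](divn_eq (a %/ m) q); lia.
Qed.

(** The digit of [x] depends only on [x] modulo [m * q]. *)
Lemma eqmod_digit {x y m q N : nat} : (m * q %| N)%N -> x = y %[mod N] ->
  ((x %/ m) %% q = (y %/ m) %% q)%N.
Proof.
move=> dvdN E; rewrite !modn_divl [(q * m)%N]mulnC.
by rewrite -(modn_dvdm x dvdN) E modn_dvdm.
Qed.

Lemma entry_step {d} {n : 'rV[nat]_d} {f} {p u : 'rV[int]_d} z i :
  prebasis n -> X_ n f ->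
  face_data p u -> face_data (p + e_ i) u ->
  entry (f z) (p + e_ i) (p + e_ i + u) = entry (f (z + e_ i)) p (p + u).
Proof.
move=> n0 [fT fX] h h'; have := fX z i.
have [a _ <-] := fT z; have [b _ <-] := fT (z + e_ i).
have [hp hu o] := h; have [hp' _ o'] := h'.
have pi : p 0 i = -1.
  have := cornerP i hp'; rewrite !mxE !eqxx.
  by case: (cornerP i hp) => -> // [].
have fui : u 0 i = 0 by case: (cornerP i hu) => // ui; case: (o i).
have ej (j : 'I_d) : (e_ i : 'rV[int]_d) 0 j = (j == i)%:R by rewrite !mxE.
(* Both facets in the matching condition have direction [c], so [mnat n c] is the modulus N /
   n_i. *)
pose c : 'rV[int]_d := const_mx (-1) + e_ i.
have corn (w : 'rV[int]_d) : (forall j, w 0 j = -1 \/ w 0 j = 0) -> corner w.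
  by move=> H; apply/forallP => j; case: (H j) => ->; rewrite eqxx ?orbT.
have cE j : c 0 j = if j == i then 0 else -1.
  by rewrite mxE ej mxE; case: eqP.
have cc : corner c by apply: corn => j; rewrite cE; case: eqP; [right|left].
have f0 : face_data 0 c.
  by split=> // [|j]; [apply: corn => j; right; rewrite mxE|rewrite mxE; case].
have ce : corner (- e_ i : 'rV[int]_d).
  by apply: corn => j; rewrite mxE ej; case: eqP; [left|right].
have f1 : face_data (- e_ i) c.
  by split=> // j; rewrite cE mxE ej; case: eqP => _ [].
(* This splits [mnat n p] as n_i times [mnat n (p + e_ i)]. *)
have f2 : face_data (- e_ i) (p + e_ i).
  split=> // j; rewrite !mxE eqxx /=.
  by case: (j =P i) => [->|_] /=; rewrite ?pi => -[].
(* The complement of [p + e_ i + u] in [c] is orthogonal to it, hence [mnat n (p + e_ i + u)]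
   divides [mnat n c]. *)
have f3 : face_data (p + e_ i + u) (c - (p + e_ i + u)).
  have wE j : (p + e_ i + u) 0 j = if j == i then 0 else p 0 j + u 0 j.
    by rewrite mxE [in LHS]mxE ej; case: eqP => [->|_]; rewrite ?pi ?fui ?addr0.
  have W j : (p + e_ i + u) 0 j = -1 \/ (p + e_ i + u) 0 j = 0.
    rewrite wE; case: eqP => [_|_]; first by right.
    case: (cornerP j hp) (cornerP j hu) (o j) => -> [] -> H.
    - by case: H.
    - by left.
    - by left.
    - by right.
  have D j : (c - (p + e_ i + u)) 0 j = c 0 j - (p + e_ i + u) 0 j.
    by rewrite mxE [in X in _ + X]mxE.
  split; first exact: corn.
    apply: corn => j; rewrite D cE; have := W j; rewrite wE.
    by case: eqP => _; lia.
  move=> j; rewrite D cE; have := W j; rewrite wE.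
  by case: eqP => _; lia.
(* Both sides of the matching condition are put in the form [p + u] that [entry_cube] expects, with
   [u] equal to [c]. *)
rewrite -[const_mx (-1)](addrK (e_ i)) -/c subrK [c - _]addrC
  -[c in entry _ 0 c]add0r.
rewrite !entry_cube // => E.
have -> : mnat n p = (mnat n (- e_ i) * mnat n (p + e_ i))%N.
  by rewrite -mnatD // addrCA addNr addr0.
rewrite divnMA; apply: (eqmod_digit (N := mnat n c)).
  by rewrite -mnatD // -[c](subrKC (p + e_ i + u)) [X in (_ %| X)%N]mnatD //
     dvdn_mulr.
rewrite -E; suff -> : mnat n 0 = 1%N by rewrite divn1.
by rewrite /mnat big1 // => j _; rewrite mxE.
Qed.

(** Induction on the number of nonzero coordinates of [v]. *)
Lemma entry_translate {d} {n : 'rV[nat]_d} {f p u} {v : 'rV[int]_d} z :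
  prebasis n -> X_ n f ->
  face_data p u -> face_data (p + v) u ->
  entry (f z) (p + v) (p + v + u) = entry (f (z + v)) p (p + u).
Proof.
move=> n0 fX h; have [k] := ubnP #|[pred j : 'I_d | v 0 j != 0]|.
elim: k v z => // k IH v z; rewrite ltnS => hk h'.
case: (pickP [pred j : 'I_d | v 0 j != 0]) => [i /= vi|v0]; last first.
  suff -> : v = 0 by rewrite !addr0.
  by apply/rowP => j; rewrite mxE; apply/eqP; have := v0 j => /negbFE.
have [hp hu o] := h; have [hp' _ o'] := h'.
(* Resetting coordinate [i] of [v] to 0 gives a hyperface again: each coordinate comes from [p] or
   from [p + v]. *)
have shrink (w : 'rV[int]_d) :
    (forall j : 'I_d, w 0 j = if j == i then 0 else v 0 j) ->
    (#|[pred j : 'I_d | w 0%R j != 0%R]| < k)%N /\ face_data (p + w) u.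
  move=> wE; split.
    apply: leq_trans hk; apply: proper_card; apply/properP; split.
      by apply/fintype.subsetP => j; rewrite !inE wE; case: (j =P i).
    by exists i; rewrite !inE // wE !eqxx.
  split=> // [|j].
    apply/forallP => j; rewrite mxE wE; case: (j =P i) => [->|_].
      by rewrite addr0; exact: (forallP hp).
    by have := forallP hp' j; rewrite mxE.
  rewrite mxE wE; case: (j =P i) => [->|_]; first by rewrite addr0; exact: o.
  by have := o' j; rewrite mxE.
have [vE|vE] : v 0 i = 1 \/ v 0 i = -1.
- have := cornerP i hp'; rewrite mxE; have := cornerP i hp.
  by move/eqP: vi; move: (v 0 i) (p 0 i) => x y; lia.
- have [|lt hw] := shrink (v - e_ i).
    by move=> j; rewrite !mxE eqxx /=; case: (j =P i) => [->|_];
      rewrite ?vE ?subrr ?subr0.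
  have := entry_step z i n0 fX hw.
  rewrite -addrA subrK => -> //.
  by rewrite IH // addrA addrAC addrK.
(* Here the unit step is read backwards, from [p + v + e_ i] at [z - e_ i] to [p + v] at [z]. *)
- have [|lt hw] := shrink (v + e_ i).
    by move=> j; rewrite !mxE eqxx /=; case: (j =P i) => [->|_];
      rewrite ?vE ?addNr ?addr0.
  have := entry_step (z - e_ i) i n0 fX h'.
  rewrite subrK -[p + v + e_ i]addrA => <- //.
  by rewrite IH // addrACA addNr addr0.
Qed.

Lemma label_faceAt (R : realType) {d} (p u : 'rV[int]_d) t : face_data p u ->
  label (faceAt R p u) t = entry t p (p + u).
Proof.
move=> h; rewrite /label; case: xgetP => [[p' u'] _ [/= h' E]|].
  by have [-> ->] := faceAt_inj h h' E.
by move=> /(_ (p, u)) [].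
Qed.

(** Since the translate stays in the cube, [v] vanishes in the free directions of the face and
    [p + v] is a corner. *)
Lemma translate_faceAt {R : realType} {d} {p u v : 'rV[int]_d} :
  face_data p u -> hyperfaces (translate (faceAt R p u) v) ->
  face_data (p + v) u /\ translate (faceAt R p u) v = faceAt R (p + v) u.
Proof.
move=> h [p' [u' [_ E]]]; have [hp hu o] := h.
have inC (x : R) j : -1 <= x <= 0 ->
    -1 <= (if u 0 j == 0 then (p 0 j)%:~R else x) + (v 0 j)%:~R <= 0.
  move=> hx; pose w : 'rV[R]_d := \row_j (if u 0 j == 0 then (p 0 j)%:~R else x).
  have : faceAt R p u w.
    split=> k; rewrite mxE; last by move=> ->; rewrite eqxx.
    by case: eqP => // _; case: (cornerP k hp) => ->; lra.
  move=> hw; have : translate (faceAt R p u) v (w + map_mx intr v) by exists w.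
  by rewrite E => -[/(_ j)]; rewrite !mxE.
have x0 : -1 <= (0 : R) <= 0 by lra.
have x1 : -1 <= (-1 : R) <= 0 by lra.
(* In a free direction both endpoints 0 and -1 must stay in [-1, 0] after the shift. *)
have vu j : u 0 j = -1 -> v 0 j = 0.
  move=> uj; move: (inC _ j x0) (inC _ j x1); rewrite uj /=.
  rewrite add0r => /andP[_ +] /andP[+ _].
  by rewrite lerDl ler0z lerz0; lia.
have h' : face_data (p + v) u.
  split=> // [|j []]; last first.
    by rewrite mxE => + uj; rewrite vu // addr0 => pj; apply: (o j).
  apply/forallP => j; case: (cornerP j hu) => uj.
    by rewrite mxE vu // addr0; exact: (forallP hp).
  have := inC _ j x0; rewrite uj eqxx -intrD mxE lerz0.
  rewrite -[-1 : R]/((-1)%:~R) ler_int; move: (p 0 j + v 0 j) => x; lia.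
split=> //; apply/seteqP; split=> [_ [w [w1 w2] <-]|w [w1 w2]].
  split=> j; last by move=> uj; rewrite !mxE w2 // intrD.
  rewrite !mxE; have := inC _ j (w1 j); case: eqP => // uj.
  by rewrite w2.
exists (w - map_mx intr v); last by rewrite subrK.
split=> j; last by move=> uj; rewrite !mxE w2 // mxE intrD addrK.
rewrite !mxE; case: (cornerP j hu) => uj; first by rewrite vu // subr0.
rewrite w2 // mxE intrD addrK; case: (cornerP j hp) => ->; lra.
Qed.

Theorem theorem4p6 (R : realType) (d : nat) (n : 'rV[nat]_d)
    (f : 'rV[int]_d -> labelling d) (s : set 'rV[R]_d) (v z : 'rV[int]_d) :
  prebasis n -> X_ n f ->
  hyperfaces s -> hyperfaces (translate s v) ->
  label (translate s v) (f z) = label s (f (z + v)).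
Proof.
move=> n0 fX [p [u [h ->]]] ht.
have [h' ->] := translate_faceAt h ht.
by rewrite !label_faceAt //; exact: (entry_translate z n0 fX).
Qed.
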